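(* For every nonzero $v=9\ell+8\ell'$ with $\ell,\ell'\in\{0,1,2,\dots\}$, there exists a $3$-way $3$-homogeneous $(v,3,2)$ Steiner trade of volume $v$.
   Context: Let $V$ be a finite set with $v$ elements and let $t<k<v$ be positive integers. A $\mu$-way $(v,k,t)$ trade $T=\{T_1,\dots,T_\mu\}$ of volume $m$ consists of $\mu$ pairwise disjoint collections $T_1,\dots,T_\mu$, each of $m$ blocks ($k$-subsets of $V$), such that every $t$-subset of $V$ is contained in the same number of blocks in each $T_i$. The foundation $\mathrm{found}(T)$ is the set of elements covered by the blocks. It is a Steiner trade if every $t$-subset of $\mathrm{found}(T)$ is in at most one block of each $T_i$, and $d$-homogeneous if every element of $V$ lies in exactly $d$ blocks of each $T_i$. *)

(* Defs.v *)
From mathcomp Require Import all_boot.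
Set Implicit Arguments.
Unset Strict Implicit.
Unset Printing Implicit Defensive.

Section Trades.

Variables (V : finType) (mu : nat).

Implicit Types (T : 'I_mu -> {set {set V}}) (B S : {set V}).

Definition blocks_through (F : {set {set V}}) S : nat :=
  #|[set B in F | S \subset B]|.

Definition way_trade (v k t m : nat) T : Prop :=
  [/\ #|V| = v,
      [&& 0 < t, t < k & k < v],
      (forall i, #|T i| = m /\ forall B, B \in T i -> #|B| = k),
      (forall i j, i != j -> [disjoint T i & T j])
    & (forall S, #|S| = t ->
         forall i j, blocks_through (T i) S = blocks_through (T j) S)].

Definition found T : {set V} := \bigcup_(i < mu) cover (T i).

(* Under the Steiner condition a collection cannot contain the same block
   twice (as t < k), so modelling collections as sets loses no generality. *)
Definition steiner (t : nat) T : Prop :=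
  forall S, S \subset found T -> #|S| = t ->
    forall i, blocks_through (T i) S <= 1.

Definition homogeneous (d : nat) T : Prop :=
  forall (x : V) i, #|[set B in T i | x \in B]| = d.

End Trades.

(* Main.v *)
Require Import Defs.
From mathcomp Require Import all_boot.

(** Point-disjoint unions add volumes, so it suffices to have a trade on 9 and
    one on 8 points. On 9 points take the three Latin squares
    [x + y + z = i] over Z_3, which decompose K_{3,3,3}. On 8 points take three
    pairwise disjoint decompositions of K_{2,2,2,2} into triangles (copies of
    the affine plane of order 3 with one point removed). *)

Section IndexedTrades.

Set Implicit Arguments.
Unset Strict Implicit.

Variables mu k : nat.

Definition pair_degree (V J : finType) (B : J -> {set V}) (x y : V) : nat :=
  #|[set j | (x \in B j) && (y \in B j)]|.

(* The volume equals the number of points, so the blocks of each collection are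
   indexed by the points themselves. The pair [x, x] counts the blocks
   through [x]. *)
Definition indexed_trade (V : finType) (B : 'I_mu -> V -> {set V}) : Prop :=
  [/\ forall i j, #|B i j| = k,
      forall i i' j j', B i j = B i' j' -> (i, j) = (i', j'),
      forall i x, pair_degree (B i) x x = k,
      forall i x y, x != y -> pair_degree (B i) x y <= 1
    & forall i i' x y, pair_degree (B i) x y = pair_degree (B i') x y].

Lemma mem_inl_imset (V W : finType) (A : {set V}) (x : V) :
  (@inl V W x \in inl @: A) = (x \in A).
Proof. by apply: mem_imset => a b []. Qed.

Lemma mem_inr_imset (V W : finType) (A : {set W}) (x : W) :
  (@inr V W x \in inr @: A) = (x \in A).
Proof. by apply: mem_imset => a b []. Qed.

Lemma inr_notin_inl_imset (V W : finType) (A : {set V}) (y : W) :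
  (inr y \in inl @: A) = false.
Proof. by apply/imsetP => -[]. Qed.

Lemma inl_notin_inr_imset (V W : finType) (A : {set W}) (x : V) :
  (inl x \in inr @: A) = false.
Proof. by apply/imsetP => -[]. Qed.

Definition mem_sum_imset :=
  (mem_inl_imset, mem_inr_imset, inr_notin_inl_imset, inl_notin_inr_imset).

(** The index type is a sum too: with [J := V] and [K := W] the union is again indexed by its own
    points, as [indexed_trade] demands. *)
Definition sum_blocks (V W J K : finType)
    (B : J -> {set V}) (C : K -> {set W}) (j : J + K) : {set V + W} :=
  match j with inl a => inl @: B a | inr b => inr @: C b end.

Lemma pair_degree_sum (V W J K : finType)
    (B : J -> {set V}) (C : K -> {set W}) (x y : V + W) :
  pair_degree (sum_blocks B C) x y =
  match x, y with
  | inl a, inl b => pair_degree B a b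
  | inr a, inr b => pair_degree C a b
  | _, _ => 0
  end.
Proof.
case: x => a; case: y => b; rewrite /pair_degree.
- rewrite -(card_imset _ (@inl_inj J K)); apply: eq_card => -[] j;
    by rewrite !inE /= !mem_sum_imset ?inE.
- by apply: eq_card0 => -[] j; rewrite !inE /= !mem_sum_imset // andbF.
- by apply: eq_card0 => -[] j; rewrite !inE /= !mem_sum_imset // andbF.
- rewrite -(card_imset _ (@inr_inj J K)); apply: eq_card => -[] j;
    by rewrite !inE /= !mem_sum_imset ?inE.
Qed.

(** No block meets both summands, so a mixed pair has degree 0 in every collection, while the other
    degrees are inherited from [B] or [C]. *)
Lemma indexed_trade_sum (V W : finType)
    (B : 'I_mu -> V -> {set V}) (C : 'I_mu -> W -> {set W}) :
  0 < k -> indexed_trade B -> indexed_trade C ->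
  indexed_trade (fun i => sum_blocks (B i) (C i)).
Proof.
move=> k_gt0 [Bk Binj Bd B1 Beq] [Ck Cinj Cd C1 Ceq].
(* A left image and a right image could agree only if both were empty, which [0 < k] excludes. *)
have inlr_neq i i' a b : @inl V W @: B i a <> inr @: C i' b.
  have /card_gt0P[x xB] : 0 < #|B i a| by rewrite Bk.
  by move/setP/(_ (inl x)); rewrite !mem_sum_imset xB.
split.
- by move=> i [] j /=; rewrite card_imset // => a b [].
- move=> i i' [] a [] b /= E.
  + by case: (Binj i i' a b (imset_inj inl_inj E)) => -> ->.
  + by case: (inlr_neq i i' a b).
  + by case: (inlr_neq i' i b a).
  + by case: (Cinj i i' a b (imset_inj inr_inj E)) => -> ->.
- by move=> i [] x; rewrite pair_degree_sum.
- by move=> i [] x [] y xy; rewrite pair_degree_sum //; [apply: B1 | apply: C1].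
- by move=> i i' [] x [] y; rewrite !pair_degree_sum.
Qed.

Definition blocks_of_lists (n : nat) (D : seq (seq (seq nat)))
    (i : 'I_mu) (j : 'I_n) : {set 'I_n} :=
  [set x | val x \in nth [::] (nth [::] D i) j].

Definition list_degree (n : nat) (bs : seq (seq nat)) (x y : nat) : nat :=
  count (fun j => (x \in nth [::] bs j) && (y \in nth [::] bs j)) (iota 0 n).

(** The five clauses of [indexed_trade], in the same order, as a boolean on natural numbers, so that
    a concrete system is verified by evaluation. Blocks are compared by membership because lists
    that differ only in order give the same set. *)
Definition check_lists (n : nat) (D : seq (seq (seq nat))) : bool :=
  let I := iota 0 mu in let P := iota 0 n in
  let b i j := nth [::] (nth [::] D i) j in
  let deg i := list_degree n (nth [::] D i) in
  [&& all (fun i => all (fun j => count [in b i j] P == k) P) I,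
      all (fun i => all (fun i' => all (fun j => all (fun j' =>
        all (fun x => (x \in b i j) == (x \in b i' j')) P ==>
          ((i == i') && (j == j'))) P) P) I) I,
      all (fun i => all (fun x => deg i x x == k) P) I,
      all (fun i => all (fun x => all (fun y =>
        (x != y) ==> (deg i x y <= 1)) P) P) I
    & all (fun i => all (fun i' => all (fun x => all (fun y =>
        deg i x y == deg i' x y) P) P) I) I].

Lemma card_ord_count (n : nat) (p : pred nat) :
  #|[set x : 'I_n | p x]| = count p (iota 0 n).
Proof. by rewrite cardsE cardE size_filter -val_enum_ord count_map enumT. Qed.

Lemma all_iotaP (n : nat) (p : pred nat) :
  all p (iota 0 n) -> forall x : 'I_n, p x.
Proof. by move=> /allP h x; apply: h; rewrite mem_iota ltn_ord. Qed.

Lemma indexed_trade_of_lists (n : nat) (D : seq (seq (seq nat))) :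
  check_lists n D -> indexed_trade (@blocks_of_lists n D).
Proof.
have degE i (x y : 'I_n) : pair_degree (@blocks_of_lists n D i) x y
    = list_degree n (nth [::] D i) x y.
  by rewrite /list_degree -card_ord_count; apply: eq_card => j; rewrite !inE.
case/and5P => h1 h2 h3 h4 h5; split.
- move=> i j; have /eqP <- := all_iotaP (all_iotaP h1 i) j.
  by rewrite -card_ord_count.
- move=> i i' j j' /setP E.
  have := all_iotaP (all_iotaP (all_iotaP (all_iotaP h2 i) i') j) j'.
  move/implyP => /(_ _)/andP[]; last by move=> /eqP/val_inj-> /eqP/val_inj->.
  apply/allP => x; rewrite mem_iota /= => ltxn.
  by have := E (Ordinal ltxn); rewrite !inE /= => ->.
- by move=> i x; rewrite degE; apply/eqP/(all_iotaP (all_iotaP h3 i)).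
- move=> i x y xy; rewrite degE.
  by have /implyP := all_iotaP (all_iotaP (all_iotaP h4 i) x) y; apply.
- move=> i i' x y; rewrite !degE; apply/eqP.
  exact: (all_iotaP (all_iotaP (all_iotaP (all_iotaP h5 i) i') x) y).
Qed.

(** Distinct indices of a collection give distinct blocks, so counting blocks amounts to counting
    indices. *)
Lemma card_indexed_blocks (V : finType) (B : 'I_mu -> V -> {set V}) i
    (P : pred {set V}) :
  indexed_trade B ->
  #|[set A in [set B i j | j in V] | P A]| = #|[set j | P (B i j)]|.
Proof.
move=> [_ Binj _ _ _].
have inj : injective (B i) by move=> j j' /Binj[].
rewrite -(card_imset _ inj); apply: eq_card => A; rewrite !inE.
apply/andP/imsetP => [[/imsetP[j _ ->] Pj] | [j]]; last first.
  by rewrite inE => Pj ->; rewrite imset_f.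
by exists j; rewrite // inE.
Qed.

Lemma blocks_through_pair (V : finType) (B : 'I_mu -> V -> {set V}) i x y :
  indexed_trade B ->
  blocks_through [set B i j | j in V] [set x; y] = pair_degree (B i) x y.
Proof.
move=> tB; rewrite /blocks_through card_indexed_blocks //.
by apply: eq_card => j; rewrite !inE subUset !sub1set.
Qed.

(** Joint injectivity in [(i, j)] gives both the volume and the disjointness of the collections.
    Degrees of pairs of distinct points give the balance and Steiner conditions, and the diagonal
    degrees give homogeneity. *)
Lemma indexed_trade_is_trade (V : finType) (B : 'I_mu -> V -> {set V}) :
  2 < k < #|V| -> indexed_trade B ->
  let T i := [set B i j | j in V] in
  [/\ way_trade #|V| k 2 #|V| T, steiner 2 T & homogeneous k T].
Proof.
move=> /andP[k_gt2 ltkV] tB T; have [Bk Binj Bd B1 Beq] := tB.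
split; [split => // | |].
- by rewrite k_gt2 ltkV.
- move=> i; split=> [|A /imsetP[j _ ->] //].
  by rewrite card_imset // => j j' /Binj[].
- move=> i i' neq; rewrite -setI_eq0; apply/set0Pn => -[A].
  rewrite inE => /andP[/imsetP[j _ ->] /imsetP[j' _ /Binj[ii' _]]].
  by rewrite ii' eqxx in neq.
- by move=> S /eqP/cards2P[x [y [_ ->]]] i i'; rewrite !blocks_through_pair.
- by move=> S _ /eqP/cards2P[x [y [xy ->]]] i; rewrite blocks_through_pair ?B1.
- move=> x i; rewrite card_indexed_blocks // -(Bd i x).
  by apply: eq_card => j; rewrite !inE andbb.
Qed.

(** Adding the [m] copies to an arbitrary [B] allows chaining: first the copies on 8 points, then
    those on 9. *)
Lemma indexed_trade_mul (n m : nat) (D : seq (seq (seq nat)))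
    (V : finType) (B : 'I_mu -> V -> {set V}) :
  0 < k -> check_lists n D -> indexed_trade B ->
  exists (W : finType) (C : 'I_mu -> W -> {set W}),
    #|W| = n * m + #|V| /\ indexed_trade C.
Proof.
move=> k_gt0 /indexed_trade_of_lists tD tB.
elim: m => [|m [W [C [cW tC]]]]; first by exists V, B; rewrite muln0.
exists ('I_n + W)%type, (fun i => sum_blocks (blocks_of_lists D i) (C i)).
split; last exact: indexed_trade_sum.
by rewrite card_sum card_ord cW mulnS addnA.
Qed.

End IndexedTrades.

(** The blocks are [[:: x; 3 + y; 6 + z]] with [x + y + z = i] modulo 3 in collection [i]. Two
    entries determine the third, so each pair from different parts lies in exactly one block of each
    collection. *)
Definition latin_trade9 : seq (seq (seq nat)) :=
  [:: [:: [:: 0; 3; 6]; [:: 0; 4; 8]; [:: 0; 5; 7];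
          [:: 1; 3; 8]; [:: 1; 4; 7]; [:: 1; 5; 6];
          [:: 2; 3; 7]; [:: 2; 4; 6]; [:: 2; 5; 8]];
      [:: [:: 0; 3; 7]; [:: 0; 4; 6]; [:: 0; 5; 8];
          [:: 1; 3; 6]; [:: 1; 4; 8]; [:: 1; 5; 7];
          [:: 2; 3; 8]; [:: 2; 4; 7]; [:: 2; 5; 6]];
      [:: [:: 0; 3; 8]; [:: 0; 4; 7]; [:: 0; 5; 6];
          [:: 1; 3; 7]; [:: 1; 4; 6]; [:: 1; 5; 8];
          [:: 2; 3; 6]; [:: 2; 4; 8]; [:: 2; 5; 7]]].

(* The non-edges of K_{2,2,2,2} are the pairs [x, x + 4]. *)
Definition affine_trade8 : seq (seq (seq nat)) :=
  [:: [:: [:: 0; 1; 2]; [:: 0; 3; 5]; [:: 0; 6; 7]; [:: 1; 3; 6];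
          [:: 1; 4; 7]; [:: 2; 3; 4]; [:: 2; 5; 7]; [:: 4; 5; 6]];
      [:: [:: 0; 1; 3]; [:: 0; 2; 7]; [:: 0; 5; 6]; [:: 1; 2; 4];
          [:: 1; 6; 7]; [:: 2; 3; 5]; [:: 3; 4; 6]; [:: 4; 5; 7]];
      [:: [:: 0; 1; 6]; [:: 0; 2; 3]; [:: 0; 5; 7]; [:: 1; 2; 7];
          [:: 1; 3; 4]; [:: 2; 4; 5]; [:: 3; 5; 6]; [:: 4; 6; 7]]].

Lemma check_latin_trade9 : check_lists 3 3 9 latin_trade9.
Proof. by vm_compute. Qed.

Lemma check_affine_trade8 : check_lists 3 3 8 affine_trade8.
Proof. by vm_compute. Qed.

Theorem theorem2p3 (v l l' : nat) (hv : v = 9 * l + 8 * l') (hv0 : v <> 0) :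
  exists (V : finType) (T : 'I_3 -> {set {set V}}),
    [/\ way_trade v 3 2 v T, steiner 2 T & homogeneous 3 T].
Proof.
(* The trade without points starts the sum; [indexed_trade] sets no lower bound on the number of
   points, so it qualifies vacuously. *)
have tvoid : indexed_trade 3 (fun (_ : 'I_3) (_ : void) => set0 : {set void}).
  by split => // ? [].
have [W [C [cW tC]]] :=
  indexed_trade_mul l' (ltn0Sn 2) check_affine_trade8 tvoid.
have [V [B [cV tB]]] := indexed_trade_mul l (ltn0Sn 2) check_latin_trade9 tC.
have cardV : #|V| = v by rewrite cV cW card_void addn0 -hv.
(* As [v] is nonzero, at least one summand of 8 or 9 points is present, so [v] exceeds 3. *)
have gt3 : 2 < 3 < #|V|.
  rewrite cardV; move: hv0; rewrite hv.
  by case: (l) (l') => [|a] [|b] //; rewrite !mulnS.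
exists V, (fun i => [set B i j | j in V]).
by have := indexed_trade_is_trade gt3 tB; rewrite cardV.
Qed.
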